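(* Let $V$ be a finite dataset with $N=|V|$ elements, $\mathrm{sim}$ a symmetric real-valued similarity function, $q$ a query vector, $\epsilon\in\mathbb{R}$ a similarity threshold, and $k\ge 1$ an integer. Let $V_K\subseteq V$ satisfy $|V_K|=K$ and $\mathrm{sim}(v,q)\ge \mathrm{sim}(u,q)$ for all $v\in V_K$ and all $u\in V\setminus V_K$. Let $G^\epsilon=(V_K,E)$ be the diversity graph on $V_K$ with threshold $\epsilon$, and let $\phi_v$ denote the degree of $v$ in $G^\epsilon$. Let $\Phi\subset V_K$ be a set of $k-1$ nodes of highest degree in $G^\epsilon$, i.e. $|\Phi|=k-1$ and $\phi_v\ge\phi_u$ for all $v\in\Phi$ and $u\in V_K\setminus\Phi$. If $$K\;\ge\;\sum_{v\in\Phi}(\phi_v+1)+1,$$ then $V_K$ is sufficient to find the optimal diverse set of $V$; that is, there exists a set $R\subseteq V_K$ which is an optimal diverse set of size $k$ for the whole dataset $V$.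
   Context: The similarity function assigns a real number $\mathrm{sim}(u,v)=\mathrm{sim}(v,u)$ to a pair of vectors; $\mathrm{sim}(v,q)$ is called the similarity score of $v$ with respect to the query $q$. A set $R\subseteq V$ is a diverse set (at level $\epsilon$) if $\mathrm{sim}(r,r')<\epsilon$ for all distinct $r,r'\in R$. It is a valid diverse set if in addition $|R|=k$. An optimal diverse set of $V$ is a valid diverse set $R\subseteq V$ whose total similarity score $\sum_{r\in R}\mathrm{sim}(r,q)$ is maximal among all valid diverse sets contained in $V$. The diversity graph on a set $W$ of vectors with threshold $\epsilon$ is the undirected simple graph with node set $W$ in which two distinct nodes $v,v'$ are joined by an edge if and only if $\mathrm{sim}(v,v')\ge\epsilon$. Thus diverse subsets of $W$ are exactly the independent sets of this graph. *)

(* Defs.v *)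
From HB Require Import structures.
From mathcomp Require Import all_boot all_order all_algebra.
From mathcomp Require Import finmap.
From mathcomp Require Import reals.

Set Implicit Arguments.
Unset Strict Implicit.
Unset Printing Implicit Defensive.

Import Order.TTheory GRing.Theory Num.Theory.

Local Open Scope fset_scope.
Local Open Scope ring_scope.

(* Vectors live in an arbitrary choiceType [T] (for instance 'rV[R]_d), and
   [sim] is an arbitrary function: its symmetry is assumed where it is used. *)

Definition diverse (R : realType) (T : choiceType) (sim : T -> T -> R)
    (eps : R) (S : {fset T}) : Prop :=
  forall r r' : T, r \in S -> r' \in S -> r != r' -> sim r r' < eps.

Definition valid_diverse (R : realType) (T : choiceType) (sim : T -> T -> R)
    (eps : R) (k : nat) (S : {fset T}) : Prop :=
  diverse sim eps S /\ #|` S| = k.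

Definition total_score (R : realType) (T : choiceType) (sim : T -> T -> R)
    (q : T) (S : {fset T}) : R :=
  \sum_(r <- S) sim r q.

Definition optimal_diverse (R : realType) (T : choiceType) (sim : T -> T -> R)
    (q : T) (eps : R) (k : nat) (V S : {fset T}) : Prop :=
  [/\ S `<=` V,
      valid_diverse sim eps k S
    & forall S' : {fset T}, S' `<=` V -> valid_diverse sim eps k S' ->
        total_score sim q S' <= total_score sim q S].

(* Adjacency in the diversity graph with node set [W]; it is irreflexive by
   construction, and undirected as soon as [sim] is symmetric. *)
Definition div_edge (R : realType) (T : choiceType) (sim : T -> T -> R)
    (eps : R) (W : {fset T}) : rel T :=
  fun v v' => [&& v \in W, v' \in W, v != v' & eps <= sim v v'].

Definition degree (T : choiceType) (W : {fset T}) (e : rel T) (v : T) : nat :=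
  #|` [fset v' in W | e v v']|.

(* Main.v *)
(* An independent set A of fewer than k nodes dominates at most the sum of
   (phi_v + 1) over A, hence fewer than K nodes of V_K, so it extends inside V_K;
   thus every independent set of size at most k extends greedily to size k.
   Given any valid diverse set S' of V, extending the intersection of S' with
   V_K in this way trades the elements of S' outside V_K for elements of V_K,
   which score at least as well. *)
Require Import Defs.
From HB Require Import structures.
From mathcomp Require Import all_boot all_order all_algebra.
From mathcomp Require Import finmap.
From mathcomp Require Import reals.
From mathcomp Require Import boolp.

Set Implicit Arguments.
Unset Strict Implicit.

Import Order.TTheory GRing.Theory Num.Theory.

Local Open Scope fset_scope.
Local Open Scope ring_scope.

(** Every entry of [s] is below every entry of [t], so the entries can be paired off in list order;
    only a surplus in [t] needs a sign. *)
Lemma ler_sum_seq_cross (R : numDomainType) (T : eqType) (f : T -> R)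
    (s t : seq T) :
  (size s <= size t)%N -> ((size s < size t)%N -> {in t, forall y, 0 <= f y}) ->
  {in s & t, forall x y, f x <= f y} ->
  \sum_(x <- s) f x <= \sum_(y <- t) f y.
Proof.
elim: s t => [|x s IHs] [|y t] //= les pos le_st; rewrite ?big_nil //.
  by rewrite big_seq sumr_ge0 // => z; apply: pos.
rewrite !big_cons lerD ?IHs //.
- by rewrite le_st ?mem_head.
- by move=> lts z zt; rewrite pos // inE zt orbT.
- by move=> a b sa tb; rewrite le_st // inE ?sa ?tb orbT.
Qed.

(** The terms over the intersection cancel, which leaves the two differences; their sizes compare as
    those of [A] and [B] do. *)
Lemma ler_sum_fset_exchange (R : numDomainType) (T : choiceType) (f : T -> R)
    (A B : {fset T}) :
  (#|` A| <= #|` B|)%N ->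
  ((#|` A| < #|` B|)%N -> {in B, forall y, 0 <= f y}) ->
  {in A `\` B & B `\` A, forall x y, f x <= f y} ->
  \sum_(x <- A) f x <= \sum_(y <- B) f y.
Proof.
move=> leAB pos cross.
rewrite (big_fsetID _ [in B]) [leRHS](big_fsetID _ [in A]) /=.
have -> : [fset x in A | x \in B] = A `&` B by apply/fsetP=> x; rewrite !inE.
have -> : [fset x in A | x \notin B] = A `\` B.
  by apply/fsetP=> x; rewrite !inE andbC.
have -> : [fset x in B | x \in A] = A `&` B.
  by apply/fsetP=> x; rewrite !inE andbC.
have -> : [fset x in B | x \notin A] = B `\` A.
  by apply/fsetP=> x; rewrite !inE andbC.
rewrite lerD2l; apply: ler_sum_seq_cross => //.
  by rewrite -(leq_add2l #|` A `&` B|) cardfsID fsetIC cardfsID.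
rewrite -(ltn_add2l #|` A `&` B|) cardfsID fsetIC cardfsID => ltAB y.
by rewrite inE => /andP[_]; apply: pos.
Qed.

Lemma leq_sum_fset_exchange (T : choiceType) (f : T -> nat) (A B : {fset T}) :
  (#|` A| <= #|` B|)%N ->
  {in A `\` B & B `\` A, forall x y, (f x <= f y)%N} ->
  (\sum_(x <- A) f x <= \sum_(y <- B) f y)%N.
Proof.
move=> leAB cross; rewrite -(ler_nat int) !natr_sum.
apply: ler_sum_fset_exchange => // [_ y _|x y xA yB]; first exact: ler0n.
by rewrite ler_nat cross.
Qed.

Lemma leq_card_bigfcup (I T : choiceType) (A : {fset I}) (F : I -> {fset T}) :
  (#|` \bigcup_(i <- A) F i| <= \sum_(i <- A) #|` F i|)%N.
Proof.
elim/big_rec2: _ => [|i n B _ leB]; first by rewrite cardfs0.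
by apply: leq_trans (leq_card_fsetU _ _) _; rewrite leq_add2l.
Qed.

Section DiversityGraph.

Variables (R : realType) (T : choiceType) (sim : T -> T -> R) (eps : R).
Hypothesis sim_sym : forall u v : T, sim u v = sim v u.

Lemma diverseU1 (S : {fset T}) (w : T) :
  diverse sim eps S -> {in S, forall v, sim v w < eps} ->
  diverse sim eps (w |` S).
Proof.
move=> divS Sw r r'; rewrite !inE => /orP[/eqP->|rS] /orP[/eqP->|r'S].
- by rewrite eqxx.
- by move=> _; rewrite sim_sym Sw.
- by move=> _; rewrite Sw.
- exact: divS.
Qed.

Lemma diverse_add (W A : {fset T}) :
  A `<=` W -> diverse sim eps A ->
  (\sum_(v <- A) (degree W (div_edge sim eps W) v + 1) < #|` W|)%N ->
  exists2 w, w \in W `\` A & diverse sim eps (w |` A).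
Proof.
move=> sAW divA ltW.
(* Closed neighbourhoods: including [v] itself accounts for the [+ 1] in the bound and keeps the new
   node outside [A]. *)
pose nbhd v := v |` [fset v' in W | div_edge sim eps W v v'].
pose B := \bigcup_(v <- A) nbhd v.
have ltBW : (#|` B| < #|` W|)%N.
  apply: leq_ltn_trans (leq_card_bigfcup _ _) (leq_ltn_trans _ ltW).
  apply: leq_sum => v _; rewrite addnC.
  by apply: leq_trans (leq_card_fsetU _ _) _; rewrite cardfs1.
have /fset0Pn[w] : W `\` B != fset0.
  by apply: contraTneq ltBW => /eqP; rewrite fsetD_eq0 -leqNgt => /fsubset_leq_card.
rewrite inE => /andP[wB wW].
have wN v : v \in A -> w \notin nbhd v.
  by move=> vA; apply: contra wB => wv; apply/bigfcupP; exists v; rewrite ?vA.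
have wA : w \notin A by apply/negP=> /wN; rewrite !inE eqxx.
exists w; first by rewrite inE wA wW.
apply: diverseU1 => // v vA; have := wN v vA.
(* As [v] and [w] are distinct nodes of [W], a missing edge can only mean similarity below [eps]. *)
rewrite !inE /div_edge negb_or wW (fsubsetP sAW _ vA) eq_sym /=.
by case/andP=> ->; rewrite -ltNge.
Qed.

(** While [A] has fewer than [k] nodes, exchanging it for [Phi] does not lower the sum of
    [degree + 1], so [diverse_add] applies; the induction is on the number of missing nodes. *)
Lemma diverse_extend (W Phi A : {fset T}) (k : nat) :
  #|` Phi| = k.-1 ->
  {in Phi & W `\` Phi, forall v u,
    (degree W (div_edge sim eps W) u <= degree W (div_edge sim eps W) v)%N} ->
  (\sum_(v <- Phi) (degree W (div_edge sim eps W) v + 1) < #|` W|)%N ->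
  A `<=` W -> diverse sim eps A -> (#|` A| <= k)%N ->
  exists S : {fset T}, [/\ A `<=` S, S `<=` W & valid_diverse sim eps k S].
Proof.
move=> cardPhi topPhi ltW.
have [n] := ubnP (k - #|` A|); elim: n A => // n IHn A len sAW divA.
rewrite leq_eqVlt => /predU1P[cardA|ltAk]; first by exists A.
have ltAW : (\sum_(v <- A) (degree W (div_edge sim eps W) v + 1) < #|` W|)%N.
  apply: leq_ltn_trans ltW; apply: leq_sum_fset_exchange.
    by rewrite cardPhi -ltnS (ltn_predK ltAk).
  move=> x y; rewrite !inE => /andP[xPhi xA] /andP[_ yPhi].
  by rewrite leq_add2r topPhi // inE xPhi (fsubsetP sAW).
have [w] := diverse_add sAW divA ltAW; rewrite inE => /andP[wA wW] divwA.
have cardwA : #|` w |` A| = #|` A|.+1 by rewrite cardfsU1 wA.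
case: (IHn (w |` A)) => //.
- by rewrite cardwA subnS prednK ?subn_gt0.
- by rewrite fsubUset fsub1set wW.
- by rewrite cardwA.
move=> S [sAS sSW vS]; exists S; split=> //.
exact: fsubset_trans (fsubsetUr _ _) sAS.
Qed.

(** The candidates lie in the finite type of subsets of [W], and [S0] shows that there is one, so
    the score attains a maximum. *)
Lemma optimal_diverse_exists (q : T) (k : nat) (W S0 : {fset T}) :
  S0 `<=` W -> valid_diverse sim eps k S0 ->
  exists S, optimal_diverse sim q eps k W S.
Proof.
move=> sS0W vS0.
pose P (S : fpowerset W) := `[< valid_diverse sim eps k (val S) >].
have S0W : S0 \in fpowerset W by rewrite fpowersetE.
have PS0 : P [` S0W] by apply/asboolP.
case: (Order.TotalTheory.arg_maxP (fun S => total_score sim q (val S)) PS0).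
move=> S /asboolP vS maxS; exists (val S); split=> //.
  by rewrite -fpowersetE; apply: valP.
move=> S' sS'W vS'; have S'W : S' \in fpowerset W by rewrite fpowersetE.
by apply: (maxS [` S'W]); apply/asboolP.
Qed.

End DiversityGraph.

Theorem theorem1 (R : realType) (T : choiceType) (sim : T -> T -> R)
    (sim_sym : forall u v : T, sim u v = sim v u)
    (V : {fset T}) (N : nat) (cardV : #|` V| = N)
    (q : T) (eps : R) (k : nat) (k_ge1 : (1 <= k)%N)
    (VK : {fset T}) (K : nat) (VK_sub : VK `<=` V) (cardVK : #|` VK| = K)
    (VK_top : forall v u : T, v \in VK -> u \in V `\` VK ->
       sim u q <= sim v q)
    (Phi : {fset T}) (Phi_sub : Phi `<=` VK) (cardPhi : #|` Phi| = (k - 1)%N)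
    (Phi_top : forall v u : T, v \in Phi -> u \in VK `\` Phi ->
       (degree VK (div_edge sim eps VK) u
          <= degree VK (div_edge sim eps VK) v)%N)
    (K_large :
       (\sum_(v <- Phi) (degree VK (div_edge sim eps VK) v + 1) + 1 <= K)%N) :
  exists S : {fset T}, S `<=` VK /\ optimal_diverse sim q eps k V S.
Proof.
have cardPhi' : #|` Phi| = k.-1 by rewrite cardPhi subn1.
rewrite addn1 -cardVK in K_large.
have extend A :=
  @diverse_extend R T sim eps sim_sym VK Phi A k cardPhi' Phi_top K_large.
(* Extending the empty set yields a valid diverse set inside [VK], hence an optimum [S] within
   [VK]. *)
have [||| S0 [_ sS0 vS0]] := extend fset0.
- exact: fsub0set.
- by move=> r r'; rewrite in_fset0.
- by rewrite cardfs0.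
have [S [sSVK vS maxS]] := optimal_diverse_exists q sS0 vS0.
exists S; split=> //; split=> //; first exact: fsubset_trans VK_sub.
move=> S' sS'V [divS' cardS'].
have [||| S'' [sS'S'' sS''VK vS'']] := extend (S' `&` VK).
- exact: fsubsetIr.
- move=> r r'; rewrite !inE => /andP[rS' _] /andP[r'S' _]; exact: divS'.
- by rewrite -cardS' fsubset_leq_card ?fsubsetIl.
apply: le_trans (maxS _ sS''VK vS''); have [_ cardS''] := vS''.
(* Both sets have exactly [k] elements, so the sign condition is vacuous and scores may be
   negative. *)
apply: ler_sum_fset_exchange; rewrite ?cardS' ?cardS'' ?ltnn //.
move=> x y; rewrite !inE => /andP[xS'' xS'] /andP[_ yS''].
apply: VK_top; first exact: (fsubsetP sS''VK).
(* If [x] were in [VK], it would lie in the intersection of [S'] and [VK], which [S''] contains. *)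
rewrite inE (fsubsetP sS'V) // andbT; apply: contra xS'' => xVK.
by rewrite (fsubsetP sS'S'') // inE xS' xVK.
Qed.
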